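(* For any positive integers $a$ and $n$ with $a\ge 2$, modulo $\Phi_n(q)^2$, $$\left(\!\!\binom{an}{an-2n}\!\!\right)_q\equiv\begin{cases}(-1)^m 2\binom{a}{2}(1+q^m)q^{m(3m-1)/2}-9m(1-q^{3m})\binom{a+1}{3}+\frac{3a-a^2}{2},&\text{if } n=3m,\\ (-1)^m 2\binom{a}{2}q^{m(3m+1)/2}-3(3m+1)(1-q^{3m+1})\binom{a+1}{3}+\frac{3a-a^2}{2},&\text{if } n=3m+1,\\ (-1)^m 2\binom{a}{2}q^{m(3m-1)/2}-3(3m-1)(1-q^{3m-1})\binom{a+1}{3}+\frac{3a-a^2}{2},&\text{if } n=3m-1,\end{cases}$$ where in each case $m$ is the integer determined by $n$.
   Context: $q$ is an indeterminate. $\Phi_n(q)=\prod_{1\le k\le n,\ \gcd(n,k)=1}(q-\zeta^k)$, with $\zeta$ a primitive $n$-th root of unity, is the $n$-th cyclotomic polynomial. The $q$-shifted factorial is $(a;q)_0=1$, $(a;q)_n=(1-a)(1-aq)\cdots(1-aq^{n-1})$ for $n\ge 1$. The $q$-binomial coefficient is $\begin{bmatrix}n\\k\end{bmatrix}=\frac{(q;q)_n}{(q;q)_k(q;q)_{n-k}}$ if $0\le k\le n$, and $0$ otherwise. For integers $n\ge 0$ and $-n\le j\le n$, the $q$-trinomial coefficient is $$\left(\!\!\binom{n}{j}\!\!\right)_q=\sum_{k=0}^{n}q^{k(k+j)}\begin{bmatrix}n\\k\end{bmatrix}\begin{bmatrix}n-k\\k+j\end{bmatrix}.$$ $\binom{a}{2}$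 and $\binom{a+1}{3}$ are ordinary binomial coefficients. A congruence $A(q)\equiv B(q)$ modulo $\Phi_n(q)^2$ means that $\Phi_n(q)^2$ divides $A(q)-B(q)$ in $\mathbb{Z}[q,q^{-1}]$. *)

(* Defs.v *)
From mathcomp Require Import all_boot all_order all_algebra all_field.

Set Implicit Arguments.
Unset Strict Implicit.
Unset Printing Implicit Defensive.

Import GRing.Theory.

Local Open Scope ring_scope.

(* The field Q(q) of rational functions, realised as the fraction field of
   Z[q]; it contains Z[q] and Z[q, q^-1]. *)
Notation ratfun := {fraction {poly int}}.

Definition of_poly (p : {poly int}) : ratfun := FracField.tofrac p.

Definition q : ratfun := of_poly 'X.

(* (a; q)_n *)
Definition qshift_fact (a : ratfun) (n : nat) : ratfun :=
  \prod_(0 <= i < n) (1 - a * q ^+ i).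

Definition qbinom (n : nat) (k : int) : ratfun :=
  match k with
  | Posz k' =>
      if (k' <= n)%N then
        qshift_fact q n / (qshift_fact q k' * qshift_fact q (n - k')%N)
      else 0
  | Negz _ => 0
  end.

Definition qtrinom (n : nat) (j : int) : ratfun :=
  \sum_(0 <= k < n.+1)
     q ^ (k%:Z * (k%:Z + j)) * qbinom n k%:Z * qbinom (n - k)%N (k%:Z + j).

(* Membership in the subring Z[q, q^-1]. *)
Definition is_laurent (x : ratfun) : Prop :=
  exists (p : {poly int}) (k : nat), x = of_poly p / q ^+ k.

(* A = B modulo P, the divisibility taking place in Z[q, q^-1]. *)
Definition laurent_eqmod (A B P : ratfun) : Prop :=
  exists2 C : ratfun, is_laurent C & A - B = C * P.

(* Main.v *)
Require Import Defs.
From mathcomp Require Import all_boot all_order all_algebra all_field.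
From HB Require Import structures.
From mathcomp Require Import zify ring.
Local Open Scope ring_scope.
Set Implicit Arguments.
Unset Strict Implicit.
Unset Printing Implicit Defensive.
Import GRing.Theory.

(** Put y = 1 - q^n.  Modulo Phi_n(q)^2 two things happen: y^2 = 0, and 1 - q^i
    is not a zero divisor when n does not divide i.  The argument uses nothing
    else about the modulus, so it is carried out for an element t of an
    arbitrary commutative ring with these two properties; a relation that holds
    only modulo Phi_n(q) becomes an equality between multiples of y.

    The trinomial coefficient is the sum over 0 <= k <= n of
    q^(k(k+(a-2)n)) [an; k] [an-k; k+(a-2)n].

    For 0 < k < n, the factor [an; k] is, up to regular factors, an integer
    multiple of y ([gauss_inner]), so the other factor matters only modulo
    Phi_n(q), where the q-Lucas theorem ([q_lucas]) turns it into
    (a-1) [n-k; k].  The term is then a(a-1) times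
      (-1)^k q^C(k,2) (1 - q^n) / (1 - q^(n-k)) [n-k; k]
    ([qtrinom_inner_term]).  With its k = 0 term, equal to 1, the sum of these
    is a q-analogue of sum_k (-1)^k n/(n-k) C(n-k,k) = 2 cos(pi n/3), and it is,
    up to sign, a power of q with a pentagonal exponent, times 1 + q^m if n = 3m.
    It reduces to F_N = sum_k (-1)^k q^C(k,2) [N-k; k], for which Pascal's two
    rules give F_(N+3) = - q^(N+1) F_N ([qfib_sum0_rec3], [lucas_sumE]).  The
    k = 0 term missing from the trinomial sum accounts for -a(a-1).

    The terms k = 0 and k = n are [an; (a-2)n] and q^(n(a-1)n) [an; n].  In the
    q-Vandermonde expansion of [(A+1)n; (B+1)n] by a block of length n every
    inner term is, up to regular factors, a product of two multiples of y, so
    only the two outer ones survive ([gauss_block_rec]); the resulting Pascal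
    rule gives the expansions of these coefficients to first order in y.

    Finally the ring is Z[X] / (Phi_n^2).  There 1 - X^i is not a zero divisor
    because Phi_n is the minimal polynomial of a primitive n-th root of unity,
    of which 1 - X^i is not a multiple ([Cyclotomic_pow_cancel]). *)

(** * Gaussian binomial coefficients *)

Fixpoint gauss_rec (R : comNzRingType) (t : R) (n k : nat) : R :=
  match n, k with
  | _, 0 => 1
  | 0, _.+1 => 0
  | n'.+1, k'.+1 => gauss_rec t n' k' + t ^+ k'.+1 * gauss_rec t n' k'.+1
  end.

(** Pascal's rule makes sense in any commutative ring, where the quotient of
    q-factorials may not.  The definition is locked because unification up to
    conversion would otherwise read [gauss n.+1 k.+1] as a sum. *)
HB.lock Definition gauss (R : comNzRingType) (t : R) (n k : nat) : R :=
  gauss_rec t n k.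

Section GaussianBinomial.
Variables (R : comNzRingType) (t : R).
Local Notation gauss := (gauss t).

Lemma gauss0 n : gauss n 0 = 1.
Proof. by rewrite unlock; case: n. Qed.

Lemma gauss0S k : gauss 0 k.+1 = 0.
Proof. by rewrite unlock. Qed.

Lemma gaussS n k :
  gauss n.+1 k.+1 = gauss n k + t ^+ k.+1 * gauss n k.+1.
Proof. by rewrite unlock. Qed.

Lemma gauss_small n k : (n < k)%N -> gauss n k = 0.
Proof.
elim: n k => [|n IHn] [|k] //; first by rewrite gauss0S.
rewrite ltnS => lt_nk.
by rewrite gaussS !IHn ?mulr0 ?addr0 // ltnW.
Qed.

Lemma gaussnn n : gauss n n = 1.
Proof.
elim: n => [|n IHn]; first exact: gauss0.
by rewrite gaussS IHn gauss_small // mulr0 addr0.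
Qed.

Lemma gauss_step k d :
  (1 - t ^+ k.+1) * gauss (k + d) k.+1 = (1 - t ^+ d) * gauss (k + d) k.
Proof.
elim: k d => [|k IHk] d.
  rewrite add0n gauss0 expr1; elim: d => [|d IHd].
    by rewrite gauss_small // expr0; ring.
  by rewrite gaussS gauss0 expr1 mulrDr mulrCA IHd exprS; ring.
elim: d => [|d IHd].
  by rewrite addn0 gauss_small // expr0 subrr mul0r mulr0.
have IH := IHk d.+1; rewrite addnS addSn in IHd *; rewrite addnS in IH.
rewrite [in LHS]gaussS [in RHS]gaussS !mulrDr -IH [in LHS]mulrCA IHd.
rewrite !exprS; ring.
Qed.

Lemma gauss_absorb n k :
  (1 - t ^+ k.+1) * gauss n.+1 k.+1 = (1 - t ^+ n.+1) * gauss n k.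
Proof.
have [le_kn | lt_nk] := leqP k n; last by rewrite !gauss_small ?mulr0.
rewrite -(subnKC le_kn) gaussS mulrDr mulrCA gauss_step -addSn exprD; ring.
Qed.

(** The other form of Pascal's rule: the two forms differ by [gauss_step]. *)
Lemma gaussS_dual k d :
  gauss (k + d).+1 k.+1 = t ^+ d * gauss (k + d) k + gauss (k + d) k.+1.
Proof.
rewrite gaussS; apply/eqP; rewrite -subr_eq0; apply/eqP.
have := gauss_step k d; rewrite !mulrBl !mul1r => /eqP.
rewrite -subr_eq0 => /eqP E.
by rewrite -[RHS]oppr0 -E; ring.
Qed.

(** The q-Vandermonde identity, with the lower index written u + s so that no
    truncated subtraction occurs.  Induction on s: Pascal's rule on the left,
    its dual form on the coefficients [gauss s j]. *)
Lemma gauss_vandermonde M s u :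
  gauss (M + s) (u + s) =
  \sum_(0 <= j < s.+1) t ^+ (j * (u + j)) * gauss s j * gauss M (u + j).
Proof.
elim: s u => [|s IHs] u.
  by rewrite big_nat1 gauss0 mul0n expr0 !mul1r !addn0.
rewrite !addnS gaussS IHs -addSn IHs.
have split_j j : (j <= s)%N ->
    t ^+ (j.+1 * (u + j.+1)) * gauss s.+1 j.+1 * gauss M (u + j.+1) =
    t ^+ (j.+1 * (u + j.+1)) * gauss s j.+1 * gauss M (u + j.+1)
    + t ^+ (u.+1 + s)
      * (t ^+ (j * (u.+1 + j)) * gauss s j * gauss M (u.+1 + j)).
  move=> le_js; rewrite -{1}(subnKC le_js) gaussS_dual subnKC //.
  have -> : (j.+1 * (u + j.+1) = j * (u.+1 + j) + u + j.+1)%N by lia.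
  have -> : (u.+1 + s = u + j.+1 + (s - j))%N by lia.
  by rewrite addSnnS !exprD; ring.
rewrite [RHS]big_nat_recl // gauss0.
under [in RHS]eq_big_nat => j lt_js do rewrite split_j //.
rewrite big_split /= -mulr_sumr addrA; congr (_ + _).
rewrite big_nat_recl // gauss0 big_nat_recr //=.
by rewrite (gauss_small (leqnn s.+1)) mulr0 mul0r addr0.
Qed.

(** * Alternating q-Fibonacci and q-Lucas sums *)

(** The case i = 0 is the q-analogue of sum_k (-1)^k C(N-k,k), which has
    period 6 in N.  Pascal's rule expresses it through the case i = 1, and the
    dual form of Pascal's rule leads back from i = 1 to i = 0. *)
Definition qfib_sum (i N : nat) : R :=
  \sum_(0 <= k < N.+1) (-1) ^+ k * t ^+ ('C(k, 2) + i * k) * gauss (N - k) k.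

Lemma qfib_sum_head i N :
  qfib_sum i N.+1 =
  1 - \sum_(0 <= k < N.+1)
        (-1) ^+ k * t ^+ ('C(k, 2) + k + i * k.+1) * gauss (N - k) k.+1.
Proof.
rewrite /qfib_sum big_nat_recl // gauss0 bin0n muln0 !mulr1 expr0 -sumrN.
by congr (_ + _); apply: eq_bigr => k _; rewrite binS bin1 exprS subSS; ring.
Qed.

Lemma qfib_sum_drop i N :
  \sum_(0 <= k < N.+2)
     (-1) ^+ k * t ^+ ('C(k, 2) + k + i * k.+1) * gauss (N.+1 - k) k.+1 =
  \sum_(0 <= k < N.+1)
     (-1) ^+ k * t ^+ ('C(k, 2) + k + i * k.+1) * gauss (N - k).+1 k.+1.
Proof.
rewrite big_nat_recr //= subnn gauss0S mulr0 addr0.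
by apply: eq_big_nat => k /andP[_ le_kN]; rewrite subSn.
Qed.

Lemma qfib_sum0_rec N : qfib_sum 0 N.+2 = qfib_sum 1 N.+1 - qfib_sum 1 N.
Proof.
rewrite qfib_sum_head qfib_sum_drop qfib_sum_head -[RHS]addrA -opprD.
congr (_ - _).
rewrite -big_split /=; apply: eq_bigr => k _.
by rewrite gaussS mul0n addn0 !mul1n (exprD _ _ k.+1); ring.
Qed.

Lemma qfib_sum1_rec N :
  qfib_sum 1 N.+2 = qfib_sum 1 N.+1 - t ^+ N.+1 * qfib_sum 0 N.
Proof.
rewrite qfib_sum_head qfib_sum_drop qfib_sum_head -[RHS]addrA -opprD.
congr (_ - _).
rewrite mulr_sumr -big_split /=; apply: eq_bigr => k _.
have [le_k|lt_k] := leqP k (N - k); last first.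
  by rewrite !gauss_small ?mulr0 ?addr0 // ltnW.
rewrite -{1}(subnKC le_k) gaussS_dual subnKC //.
have -> : t ^+ N.+1 = t ^+ (k + k.+1 + (N - k - k)).
  by congr (_ ^+ _); lia.
by rewrite mul0n addn0 !mul1n !exprD; ring.
Qed.

(** The two recurrences combine so that the sums with i = 1 cancel: the three
    residue classes of N modulo 3 decouple, and each of them is a product. *)
Lemma qfib_sum0_rec3 N : qfib_sum 0 N.+3 = - t ^+ N.+1 * qfib_sum 0 N.
Proof. by rewrite qfib_sum0_rec qfib_sum1_rec; ring. Qed.

Lemma qfib_sum0_small :
  [/\ qfib_sum 0 0 = 1, qfib_sum 0 1 = 1 & qfib_sum 0 2 = 0].
Proof.
rewrite /qfib_sum !big_nat_recr ?big_geq //= !gauss0 !gauss0S /= ?expr0.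
by rewrite gaussS gauss0 gauss0S; split; ring.
Qed.

(** The exponent m + 3 C(m,2) is the pentagonal number m(3m-1)/2, and
    2m + 3 C(m,2) below is m(3m+1)/2. *)
Lemma qfib_sum0_mod0 m :
  qfib_sum 0 (3 * m) = (-1) ^+ m * t ^+ (m + 3 * 'C(m, 2)).
Proof.
elim: m => [|m IHm].
  by rewrite !muln0 !expr0 mulr1; case: qfib_sum0_small.
rewrite mulnS qfib_sum0_rec3 IHm binS bin1.
have -> : (m.+1 + 3 * ('C(m, 2) + m) = (3 * m).+1 + (m + 3 * 'C(m, 2)))%N.
  by lia.
by rewrite (exprD t (S _)) !exprS; ring.
Qed.

Lemma qfib_sum0_mod1 m :
  qfib_sum 0 (3 * m).+1 = (-1) ^+ m * t ^+ (2 * m + 3 * 'C(m, 2)).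
Proof.
elim: m => [|m IHm].
  by rewrite !muln0 !expr0 mulr1; case: qfib_sum0_small.
rewrite mulnS qfib_sum0_rec3 IHm binS bin1.
have -> : (2 * m.+1 + 3 * ('C(m, 2) + m) =
    (3 * m).+2 + (2 * m + 3 * 'C(m, 2)))%N.
  by lia.
by rewrite (exprD t (S _)) !exprS; ring.
Qed.

Lemma qfib_sum0_mod2 m : qfib_sum 0 (3 * m).+2 = 0.
Proof.
elim: m => [|m IHm]; first by rewrite muln0; case: qfib_sum0_small.
by rewrite mulnS qfib_sum0_rec3 IHm mulr0.
Qed.

(** A division-free form of (1 - t^n) / (1 - t^(n-k)) [n-k; k], for
    0 < k < n: see [lucas_termE]. *)
Definition lucas_term (n k : nat) : R :=
  gauss (n - k) k + t ^+ (n - k) * gauss (n - k).-1 k.-1.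

Lemma lucas_termE n k : (0 < k < n)%N ->
  (1 - t ^+ (n - k)) * lucas_term n k = (1 - t ^+ n) * gauss (n - k) k.
Proof.
case/andP; case: k => // k _ lt_kn; rewrite /lucas_term.
have -> : (n - k.+1 = (n - k.+2).+1)%N by lia.
have := gauss_absorb (n - k.+2) k; set p := (n - k.+2)%N => /= E.
have -> : n = (p.+1 + k.+1)%N by rewrite /p; lia.
rewrite mulrDr mulrCA -E exprD; ring.
Qed.

Definition lucas_sum (n : nat) : R :=
  \sum_(1 <= k < n) (-1) ^+ k * t ^+ 'C(k, 2) * lucas_term n k.

(** [lucas_sum] leaves out the term k = 0, equal to 1; the two summands of
    [lucas_term] give [qfib_sum 0] at n + 2 and at n. *)
Lemma lucas_sumE n :
  1 + lucas_sum n.+2 = qfib_sum 0 n.+2 - t ^+ n.+1 * qfib_sum 0 n.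
Proof.
rewrite /lucas_sum big_add1 /= qfib_sum_head -!addrA; congr (_ + _).
rewrite qfib_sum_drop mulr_sumr -opprD -big_split -sumrN /=.
apply: eq_big_nat => k /andP[_ le_kn].
rewrite /lucas_term subSS subSn // binS bin1 exprS !mul0n !addn0 /=.
have -> : t ^+ n.+1 = t ^+ (n - k).+1 * t ^+ k.
  by rewrite -exprD; congr (_ ^+ _); lia.
rewrite exprD; ring.
Qed.

Lemma lucas_sum_mod0 m :
  1 + lucas_sum (3 * m.+1) =
  (-1) ^+ m.+1 * (1 + t ^+ m.+1) * t ^+ (m.+1 + 3 * 'C(m.+1, 2)).
Proof.
have D3 : (3 * m.+1 = (3 * m).+3)%N by lia.
rewrite D3 lucas_sumE -D3 qfib_sum0_mod0 qfib_sum0_mod1.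
transitivity ((-1) ^+ m.+1 * t ^+ (m.+1 + 3 * 'C(m.+1, 2))
   + (-1) ^+ m.+1 * (t ^+ (3 * m).+2 * t ^+ (2 * m + 3 * 'C(m, 2)))).
  by rewrite [(-1) ^+ _]exprS; ring.
have -> : t ^+ (3 * m).+2 * t ^+ (2 * m + 3 * 'C(m, 2)) =
    t ^+ m.+1 * t ^+ (m.+1 + 3 * 'C(m.+1, 2)).
  by rewrite -!exprD binS bin1; congr (_ ^+ _); lia.
ring.
Qed.

Lemma lucas_sum_mod1 m :
  1 + lucas_sum (3 * m).+1 = (-1) ^+ m * t ^+ (2 * m + 3 * 'C(m, 2)).
Proof.
case: m => [|m].
  by rewrite /lucas_sum big_geq // bin_small // !muln0 !expr0 addr0 mulr1.
have D3 : (3 * m.+1 = (3 * m).+3)%N by lia.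
by rewrite D3 lucas_sumE -D3 qfib_sum0_mod1 qfib_sum0_mod2 mulr0 subr0.
Qed.

Lemma lucas_sum_mod2 m :
  1 + lucas_sum (3 * m).+2 = (-1) ^+ m.+1 * t ^+ (m.+1 + 3 * 'C(m.+1, 2)).
Proof.
rewrite lucas_sumE qfib_sum0_mod2 qfib_sum0_mod0 binS bin1.
have -> : (m.+1 + 3 * ('C(m, 2) + m) = (3 * m).+1 + (m + 3 * 'C(m, 2)))%N.
  by lia.
by rewrite (exprD t (3 * m).+1) [(-1) ^+ m.+1]exprS; ring.
Qed.

End GaussianBinomial.

(** * Gaussian binomials at a root of unity to second order *)

Section SecondOrderRootOfUnity.
Variables (R : comNzRingType) (t : R) (n : nat).
Local Notation gauss := (gauss t).
Local Notation y := (1 - t ^+ n).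

(* The image of q in Z[q] / (Phi_n(q)^2) is the model for t. *)
Hypothesis n_gt0 : (0 < n)%N.
Hypothesis y_sqr0 : y * y = 0.
Hypothesis reg_t : forall i, ~~ (n %| i)%N -> GRing.lreg (1 - t ^+ i).

Lemma exp_block B : t ^+ (B * n) = 1 - B%:R * y.
Proof.
elim: B => [|B IHB]; first by rewrite mul0n mul0r subr0.
rewrite mulSn exprD IHB; set w := y; have w_sqr0 : w * w = 0 by [].
have -> : t ^+ n = 1 - w by rewrite subKr.
transitivity (1 - (1 + B%:R) * w + B%:R * (w * w)); first by ring.
by rewrite w_sqr0 mulrS; ring.
Qed.

Lemma y_exp_block B i : y * t ^+ (B * n + i) = y * t ^+ i.
Proof.
by rewrite exprD exp_block mulrA mulrBr mulrCA y_sqr0 mulr0 subr0 mulr1.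
Qed.

Lemma lreg_exp i : GRing.lreg (t ^+ i).
Proof.
apply: lregX => u v tuv.
have: t ^+ n * u = t ^+ n * v by rewrite -(prednK n_gt0) exprSr -!mulrA tuv.
have inv z : z = (1 + y) * (t ^+ n * z).
  rewrite -{2}(subKr 1 (t ^+ n)) mulrA; set w := y.
  have -> : (1 + w) * (1 - w) = 1 - w * w by ring.
  by rewrite y_sqr0 subr0 mul1r.
by move=> E; rewrite (inv u) (inv v) E.
Qed.

Lemma gauss_block_absorb A i : ~~ (n %| i)%N ->
  exists z, (1 - t ^+ i) * gauss (A * n) i = y * z.
Proof.
case: i => [|i] ndvd_i; first by rewrite dvdn0 in ndvd_i.
case DAn: (A * n)%N => [|N]; first by exists 0; rewrite gauss0S !mulr0.
exists (A%:R * gauss N i).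
by rewrite gauss_absorb -DAn exp_block; ring.
Qed.

Lemma y_gauss_block0 A i : ~~ (n %| i)%N -> y * gauss (A * n) i = 0.
Proof.
move=> ndvd_i; apply: (reg_t ndvd_i); have [z E] := gauss_block_absorb A ndvd_i.
by rewrite mulrCA E mulrA y_sqr0 mul0r mulr0.
Qed.

Lemma ndvd_block B k : (0 < k < n)%N -> ~~ (n %| B * n + k)%N.
Proof.
by case/andP=> k_gt0 lt_kn; rewrite dvdn_addr ?dvdn_mull // gtnNdvd.
Qed.

(** The q-Lucas theorem: multiplication by y expresses the congruence modulo
    Phi_n.  Within a row of blocks (r < n) it propagates by Pascal's rule; from
    the last row r = n - 1 to the next block, Pascal's rule for C(A, B) appears
    at multiples of n and [y_gauss_block0] applies elsewhere. *)
Lemma q_lucas A B s k : (s < n)%N -> (k < n)%N ->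
  y * gauss (A * n + s) (B * n + k) = y * ('C(A, B)%:R * gauss s k).
Proof.
have DSn C : (C.+1 * n = (C * n + n.-1).+1)%N.
  by rewrite -addnS prednK // mulSn addnC.
have split_block M C : y * gauss M.+1 (C.+1 * n) =
    y * gauss M (C * n + n.-1) + y * gauss M (C.+1 * n).
  rewrite {1}DSn gaussS -DSn mulrDr; congr (_ + _).
  by rewrite mulrA -(addn0 (C.+1 * n)%N) y_exp_block mulr1.
have row C : (forall D i, (i < n)%N ->
      y * gauss (C * n) (D * n + i) = y * ('C(C, D)%:R * (i == 0)%:R)) ->
    forall r, (r < n)%N -> forall D i, (i < n)%N ->
      y * gauss (C * n + r) (D * n + i) = y * ('C(C, D)%:R * gauss r i).
  move=> row0; elim=> [_ D i lt_in|r IHr lt_rn D [|i] lt_in].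
  - by rewrite addn0 row0 //; case: i {lt_in} => [|i]; rewrite ?gauss0 ?gauss0S.
  - rewrite addn0 addnS; case: D => [|D].
      by rewrite mul0n !gauss0 bin0 mulr1.
    rewrite split_block -(addn0 (D.+1 * n)%N) !IHr ?(ltnW lt_rn) // ?prednK //.
    by rewrite (@gauss_small _ _ r n.-1) ?gauss0 ?mulr0 ?add0r // ltn_predRL.
  rewrite !addnS !gaussS -addnS mulrDr mulrA y_exp_block -mulrA mulrCA.
  by rewrite !IHr ?(ltnW lt_rn) ?(ltnW lt_in) //; ring.
have row0 C D i : (i < n)%N ->
    y * gauss (C * n) (D * n + i) = y * ('C(C, D)%:R * (i == 0)%:R).
  elim: C D i => [|C IHC] D i lt_in.
    case: D i {lt_in} => [|D] [|i] /=.
    - by rewrite gauss0 !mulr1.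
    - by rewrite mul0n gauss0S !mulr0.
    - by rewrite gauss_small ?addn0 ?muln_gt0 ?n_gt0 // mul0r !mulr0.
    by rewrite addnS gauss0S !mulr0.
  case: i lt_in => [|i] lt_in; last first.
    by rewrite y_gauss_block0 ?ndvd_block //= !mulr0.
  rewrite addn0 mulr1; case: D => [|D]; first by rewrite gauss0 bin0.
  rewrite (DSn C) split_block -(addn0 (D.+1 * n)%N) !row ?prednK //.
  by rewrite gaussnn gauss0 binS natrD; ring.
by move=> lt_sn lt_kn; apply: row => // D i; apply: row0.
Qed.

(** Each factor is a multiple of y up to a regular element, and y^2 = 0. *)
Lemma gauss_block_cross A B j : (0 < j < n)%N ->
  gauss n j * gauss (A * n) (B * n + j) = 0.
Proof.
move=> j_bnd; have ndvd_j := ndvd_block 0 j_bnd; rewrite add0n in ndvd_j.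
have ndvd_Bj := ndvd_block B j_bnd.
have [z Ez] := gauss_block_absorb A ndvd_Bj.
have [w Ew] := gauss_block_absorb 1 ndvd_j; rewrite mul1n in Ew.
apply: (reg_t ndvd_j); apply: (reg_t ndvd_Bj).
rewrite (mulrA _ (gauss n j)) Ew mulrCA Ez !mulr0.
have -> : y * w * (y * z) = y * y * (w * z) by ring.
by rewrite y_sqr0 mul0r.
Qed.

(** By [gauss_block_cross] only the terms j = 0 and j = n of the q-Vandermonde
    expansion are nonzero. *)
Lemma gauss_block_rec A B :
  gauss (A.+1 * n) (B.+1 * n) =
  gauss (A * n) (B * n) + t ^+ (B.+1 * n * n) * gauss (A * n) (B.+1 * n).
Proof.
rewrite !(mulSnr _ n) gauss_vandermonde big_ltn // big_nat_recr //=.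
rewrite big1_seq ?add0r => [|j /andP[_]]; last first.
  by rewrite mem_index_iota => j_bnd; rewrite -mulrA gauss_block_cross ?mulr0.
by rewrite gauss0 gaussnn mul0n expr0 !mulr1 mul1r addn0 [(n * _)%N]mulnC.
Qed.

Lemma gauss_block1 a : gauss (a * n) n = a%:R - ('C(a, 2) * n)%:R * y.
Proof.
elim: a => [|a IHa].
  by rewrite mul0n -(prednK n_gt0) gauss0S mul0r subr0.
have := gauss_block_rec a 0; rewrite mul1n => ->.
rewrite mul0n gauss0 IHa exp_block binS bin1 !(natrD, natrM) -(addn1 a) natrD.
transitivity (1 + (a%:R - 'C(a, 2)%:R * n%:R * y)
   - n%:R * y * a%:R + n%:R * 'C(a,2)%:R * n%:R * (y * y)); first by ring.
by rewrite y_sqr0; ring.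
Qed.

Lemma gauss_block_codim1 a :
  gauss (a.+1 * n) (a * n) = a.+1%:R - ('C(a.+1, 2) * n)%:R * y.
Proof.
elim: a => [|a IHa]; first by rewrite !mul0n gauss0 mul0r subr0.
rewrite gauss_block_rec IHa gaussnn mulr1 exp_block.
by rewrite (binS a.+1 1) bin1 !natrM !natrD -(addn1 a.+1) natrD; ring.
Qed.

Lemma gauss_block_codim2 a :
  gauss (a.+2 * n) (a * n) = 'C(a.+2, 2)%:R - (3 * 'C(a.+2, 3) * n)%:R * y.
Proof.
elim: a => [|a IHa]; first by rewrite !mul0n gauss0 mul0r subr0.
rewrite gauss_block_rec IHa gauss_block_codim1 exp_block.
have D2 : a.+1%:R * a.+2%:R = 2 * 'C(a.+2, 2)%:R :> R.
  by rewrite -!natrM -mul_bin_diag bin1 mulnC.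
rewrite !(binS a.+2) bin1.
move: 'C(a.+2, 2) 'C(a.+2, 3) D2 => c2 c3; rewrite !(natrM, natrD).
move: a.+1%:R a.+2%:R c2%:R c3%:R n%:R {IHa} => u v {}c2 {}c3 N D2.
set w := y; have w_sqr0 : w * w = 0 by [].
transitivity (c2 + v - 3 * (c3 + c2) * N * w
   + (2 * c2 - u * v) * N * w + u * N * c2 * N * (w * w)); first by ring.
by rewrite D2 w_sqr0; ring.
Qed.

(** Up to the unit q^C(k+1,2), this says that [an-1; k] is (-1)^k q^-C(k+1,2)
    modulo y, since q^(an-i) is q^-i.  Passing from k to k + 1 multiplies by
    1 - t^(an-k-1), which differs from 1 - t^(-k-1) by a multiple of y that
    [y_gauss_block0] kills. *)
Lemma gauss_inner a k : (k.+1 < n)%N ->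
  t ^+ 'C(k.+1, 2) * (1 - t ^+ k.+1) * gauss (a * n) k.+1 =
  (-1) ^+ k * a%:R * y.
Proof.
have step m N : (1 - t ^+ m.+1) * gauss N m.+1 = (1 - t ^+ (N - m)) * gauss N m.
  have [le_mN|lt_Nm] := leqP m N; last by rewrite !gauss_small ?mulr0 // ltnW.
  by rewrite -{1 3}(subnKC le_mN) gauss_step subnKC.
elim: k => [|k IHk] lt_kn.
  by rewrite -mulrA step subn0 gauss0 exp_block bin_small // !expr0; ring.
have nz : y * gauss (a * n) k.+1 = 0.
  by apply: y_gauss_block0; rewrite gtnNdvd // ltnW.
case: (posnP a) => [-> | a_gt0].
  by rewrite mul0n gauss0S mulr0n !(mulr0, mul0r).
rewrite binS bin1 exprD -mulrA step.
have -> : t ^+ 'C(k.+1, 2) * t ^+ k.+1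
    * ((1 - t ^+ (a * n - k.+1)) * gauss (a * n) k.+1)
  = t ^+ 'C(k.+1, 2) * (t ^+ k.+1 - t ^+ (a * n)) * gauss (a * n) k.+1.
  have -> : t ^+ (a * n) = t ^+ k.+1 * t ^+ (a * n - k.+1).
    by rewrite -exprD subnKC // (leq_trans (ltnW (ltnW lt_kn))) ?leq_pmull.
  ring.
rewrite exp_block; set w := y in nz *.
transitivity (- (t ^+ 'C(k.+1, 2) * (1 - t ^+ k.+1) * gauss (a * n) k.+1) +
   t ^+ 'C(k.+1, 2) * a%:R * (w * gauss (a * n) k.+1)); first by ring.
by rewrite nz IHk ?(ltnW lt_kn) // -/w [in RHS]exprS; ring.
Qed.

(** [gauss_inner] and [lucas_termE] describe the two sides only after
    multiplication by t^C(k,2), 1 - t^k and 1 - t^(n-k); these are regular, so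
    the equality may be checked after multiplying by all three. *)
Lemma qtrinom_inner_term A k : (0 < k < n)%N ->
  t ^+ (k * (k + A * n)) * gauss (A.+2 * n) k
    * gauss (A.+1 * n + (n - k)) (A * n + k) =
  (2 * 'C(A.+2, 2))%:R * ((-1) ^+ k * t ^+ 'C(k, 2) * lucas_term t n k).
Proof.
move=> k_bnd; have /andP[k_gt0 lt_kn] := k_bnd.
have k'_bnd : (0 < n - k < n)%N by rewrite subn_gt0 lt_kn ltn_subrL k_gt0.
have ndvd_k := ndvd_block 0 k_bnd; rewrite add0n in ndvd_k.
have ndvd_k' := ndvd_block 0 k'_bnd; rewrite add0n in ndvd_k'.
apply: (reg_t ndvd_k); apply: (reg_t ndvd_k'); apply: (@lreg_exp 'C(k, 2)).
have upperE := @gauss_inner A.+2 k.-1; rewrite prednK // in upperE.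
have {}upperE := upperE lt_kn.
have lowerE := q_lucas A.+1 A (proj2 (andP k'_bnd)) lt_kn.
rewrite binSn in lowerE.
have D2 : (2 * 'C(A.+2, 2))%:R = A.+2%:R * A.+1%:R :> R.
  by rewrite -natrM -mul_bin_diag bin1.
have expE : y * t ^+ (k * (k + A * n)) = y * t ^+ (k * k).
  by rewrite -(y_exp_block (k * A) (k * k)); congr (_ * t ^+ _); lia.
have signE : (-1) ^+ k = - (-1) ^+ k.-1 :> R.
  by rewrite -{1}(prednK k_gt0) exprS mulN1r.
(* Modulo y, t^k (1 - t^(n-k)) = t^k - t^n is t^k - 1. *)
have reflE : y * (t ^+ k * (1 - t ^+ (n - k))) = - (y * (1 - t ^+ k)).
  rewrite mulrBr mulr1 -exprD subnKC ?(ltnW lt_kn) //.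
  transitivity (- (y * (1 - t ^+ k)) + y * y); first by ring.
  by rewrite y_sqr0 addr0.
have squareE : t ^+ (k * k) = t ^+ 'C(k, 2) * t ^+ 'C(k, 2) * t ^+ k.
  rewrite -!exprD; congr (_ ^+ _).
  by rewrite -{1 2}(prednK k_gt0); have := mul_bin_diag k 1; rewrite bin1; nia.
set U := gauss (A.+2 * n) k in upperE *.
set W := gauss (A.+1 * n + (n - k)) (A * n + k) in lowerE *.
set e := t ^+ 'C(k, 2) in upperE squareE *.
set p := t ^+ (k * (k + A * n)) in expE *.
set r := 1 - t ^+ (n - k).
transitivity (e * (1 - t ^+ k) * U * p * r * W); first by ring.
rewrite upperE.
transitivity ((-1) ^+ k.-1 * A.+2%:R * r * (y * p) * W); first by ring.
rewrite expE squareE.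
transitivity ((-1) ^+ k.-1 * A.+2%:R * (t ^+ k * r) * (e * e) * (y * W)).
  by ring.
rewrite lowerE.
transitivity ((-1) ^+ k.-1 * A.+2%:R * A.+1%:R * (e * e) * (y * (t ^+ k * r))
  * gauss (n - k) k); first by ring.
rewrite reflE signE D2.
transitivity (- (-1) ^+ k.-1 * A.+2%:R * A.+1%:R * (e * e) * (1 - t ^+ k)
  * (y * gauss (n - k) k)); first by ring.
by rewrite -(lucas_termE t k_bnd) -/r; ring.
Qed.

(** With a = A + 2.  The terms k = 0 and k = n contribute
    C(a,2) - 3 C(a,3) n y and (1 - (a-1) n y)(a - C(a,2) n y); as
    a(a-1) = 2 C(a,2), the coefficients of n y add up to
    -3 (C(a,3) + C(a,2)) = -3 C(a+1,3). *)
Lemma qtrinom_second_order A :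
  \sum_(0 <= k < n.+1) t ^+ (k * (k + A * n)) * gauss (A.+2 * n) k
      * gauss (A.+2 * n - k) (k + A * n) =
  (2 * 'C(A.+2, 2))%:R * (1 + lucas_sum t n)
  - (3 * n * 'C(A.+3, 3))%:R * y + (A.+2%:R - 'C(A.+2, 2)%:R).
Proof.
rewrite big_ltn // big_nat_recr //=.
have -> : \sum_(1 <= k < n) t ^+ (k * (k + A * n)) * gauss (A.+2 * n) k
      * gauss (A.+2 * n - k) (k + A * n) = (2 * 'C(A.+2, 2))%:R * lucas_sum t n.
  rewrite mulr_sumr; apply: eq_big_nat => k k_bnd.
  rewrite -qtrinom_inner_term //.
  rewrite [(A * n + k)%N]addnC; congr (_ * gauss _ _).
  by case/andP: k_bnd => _ lt_kn; rewrite mulSnr -addnBA // ltnW.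
have -> : (A.+2 * n - n = A.+1 * n)%N by rewrite mulSnr addnK.
have -> : (n + A * n = A.+1 * n)%N by rewrite mulSn.
rewrite mul0n expr0 gauss0 !mul1r subn0 add0n gaussnn mulr1.
rewrite gauss_block_codim2 gauss_block1 (mulnC n) exp_block.
have D2 : (A.+1%:R * A.+2%:R = 2 * 'C(A.+2, 2)%:R :> R).
  by rewrite -!natrM -mul_bin_diag bin1 mulnC.
rewrite (binS A.+2).
move: 'C(A.+2, 2) 'C(A.+2, 3) (lucas_sum t n) D2 => c2 c3 L.
rewrite !(natrM, natrD).
move: A.+1%:R A.+2%:R c2%:R c3%:R n%:R => u v {}c2 {}c3 N D2.
set w := y; have w_sqr0 : w * w = 0 by [].
transitivity (2 * c2 * (1 + L) - 3 * N * (c3 + c2) * w + (v - c2)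
  + (2 * c2 - u * v) * N * w + u * N * c2 * N * (w * w)); first by ring.
by rewrite D2 w_sqr0; ring.
Qed.

End SecondOrderRootOfUnity.

(** * The q-trinomial coefficient as an integer polynomial *)

Lemma rmorph_gauss (R S : comNzRingType) (f : {rmorphism R -> S}) (t : R) n k :
  f (gauss t n k) = gauss (f t) n k.
Proof.
elim: n k => [|n IHn] [|k]; rewrite ?gauss0 ?gauss0S ?rmorph1 ?rmorph0 //.
by rewrite !gaussS rmorphD rmorphM rmorphXn !IHn.
Qed.

Lemma qshift_fact_neq0 n : qshift_fact q n != 0.
Proof.
rewrite /qshift_fact prodf_seq_neq0; apply/allP => i _ /=; rewrite -exprS.
have -> : 1 - q ^+ i.+1 = of_poly (1 - 'X ^+ i.+1).
  by rewrite /of_poly rmorphB rmorph1 rmorphXn.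
rewrite /of_poly tofrac_eq0 -oppr_eq0 opprB -size_poly_gt0.
by rewrite size_XnsubC.
Qed.

Lemma gauss_qshift_fact k d :
  gauss q (k + d) k * (qshift_fact q k * qshift_fact q d) =
  qshift_fact q (k + d).
Proof.
elim: k => [|k IHk]; first by rewrite gauss0 /qshift_fact big_geq // !mul1r.
rewrite /qshift_fact !addSn !big_nat_recr //= -!exprS -!/(qshift_fact q _) -IHk.
rewrite -!mulrA mulrCA.
have := gauss_absorb q (k + d) k.
set u := gauss _ _.+1 _; set v := gauss _ _ _.
set fk := qshift_fact q k; set fd := qshift_fact q d => E.
transitivity ((1 - q ^+ k.+1) * u * (fk * fd)); first by ring.
by rewrite E; ring.
Qed.

Arguments qbinom : simpl never.

Lemma qbinomE n k : qbinom n k%:Z = gauss q n k.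
Proof.
rewrite /qbinom; case: leqP => [le_kn|lt_nk]; last by rewrite gauss_small.
rewrite -{1}(subnKC le_kn) -gauss_qshift_fact subnKC // mulfK //.
by rewrite mulf_neq0 ?qshift_fact_neq0.
Qed.

Definition qtrinom_poly (A n : nat) : {poly int} :=
  \sum_(0 <= k < n.+1) 'X ^+ (k * (k + A * n)) * gauss 'X (A.+2 * n) k
      * gauss 'X (A.+2 * n - k) (k + A * n).

(** The terms n < k of the trinomial coefficient vanish, their lower index
    k + An being larger than the upper index (A+2)n - k. *)
Lemma qtrinom_polyE A n :
  qtrinom (A.+2 * n) ((A.+2 * n)%:Z - (2 * n)%:Z) = of_poly (qtrinom_poly A n).
Proof.
have -> : ((A.+2 * n)%:Z - (2 * n)%:Z = (A * n)%:Z) by lia.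
rewrite /qtrinom /of_poly rmorph_sum (big_cat_nat (n := n.+1)) //=; last by lia.
rewrite [X in _ + X]big1_seq ?addr0 => [|k /andP[_]]; last first.
  rewrite mem_index_iota => /andP[lt_nk _].
  by rewrite -PoszD !qbinomE (@gauss_small _ _ (_ - _)) ?mulr0 //; lia.
apply: eq_big_nat => k _.
by rewrite -PoszD !qbinomE !rmorphM !rmorph_gauss rmorphXn -PoszM.
Qed.

(** * Congruences modulo the square of a cyclotomic polynomial *)

(** Phi_n is the minimal polynomial of z over Q; as it is monic, the quotient
    by it stays in Z[X]: the remainder of the division in Z[X] vanishes at z
    and is shorter than Phi_n. *)
Lemma Cyclotomic_dvd_root n (z : algC) (P : {poly int}) :
  n.-primitive_root z -> root (map_poly intr P) z ->
  exists Q, P = Q * 'Phi_n.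
Proof.
move=> prim_z.
have [p [Dp _] rootE] := minCpolyP z.
have ratrI (P' : {poly int}) :
    map_poly (ratr : rat -> algC) (map_poly intr P') = map_poly intr P'.
  by rewrite -map_poly_comp; apply: eq_map_poly => c /=; rewrite ratr_int.
have Dp' : p = map_poly intr 'Phi_n.
  apply: (map_poly_inj (ratr : {rmorphism rat -> algC})).
  by rewrite -Dp ratrI (minCpoly_cyclotomic prim_z) (Cintr_Cyclotomic prim_z).
have mon_Phi := Cyclotomic_monic n.
rewrite {1}(Pdiv.RingMonic.rdivp_eq mon_Phi P) rmorphD rmorphM /=.
set r := Pdiv.Ring.rmodp P 'Phi_n; set Q := Pdiv.Ring.rdivp P 'Phi_n.
have -> : root (map_poly intr Q * map_poly intr 'Phi_n + map_poly intr r) z =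
    root (map_poly intr r) z :> bool.
  rewrite /root hornerD hornerM.
  have : root (map_poly intr 'Phi_n) z.
    by rewrite (Cintr_Cyclotomic prim_z) root_cyclotomic.
  by move/rootP->; rewrite mulr0 add0r.
rewrite -ratrI rootE Dp' => dvd_r; exists Q.
suff r0 : r = 0 by rewrite {1}(Pdiv.RingMonic.rdivp_eq mon_Phi P) -/r r0 addr0.
apply/eqP; apply: contraTT dvd_r => nz_r; rewrite gtNdvdp //.
  by rewrite map_poly_eq0_id0 // intr_eq0 lead_coef_eq0.
rewrite !size_map_inj_poly //; try exact: intr_inj.
by rewrite Pdiv.Ring.ltn_rmodpN0 ?monic_neq0.
Qed.

(** The irreducible polynomial Phi_n is coprime to D, hence its factors can be
    split off P one at a time. *)
Lemma Cyclotomic_pow_cancel n (z : algC) (P D : {poly int}) e :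
  n.-primitive_root z -> ~~ root (map_poly intr D) z ->
  (exists Q, D * P = Q * 'Phi_n ^+ e) -> exists Q, P = Q * 'Phi_n ^+ e.
Proof.
move=> prim_z nDz; elim: e P => [|e IHe] P [Q DPQ].
  by exists P; rewrite mulr1.
have [S DS] : exists S, P = S * 'Phi_n.
  apply: (Cyclotomic_dvd_root prim_z).
  have: root (map_poly intr (D * P)) z.
    rewrite DPQ exprSr mulrA rmorphM /= rootM (Cintr_Cyclotomic prim_z).
    by rewrite (root_cyclotomic prim_z) prim_z orbT.
  by rewrite rmorphM rootM (negPf nDz).
have nz_Phi : 'Phi_n != 0 by rewrite monic_neq0 ?Cyclotomic_monic.
have [|T DT] := IHe S.
  by exists Q; apply: (mulIf nz_Phi); rewrite -!mulrA -DS DPQ exprSr.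
by exists T; rewrite DS DT -mulrA exprSr.
Qed.

Lemma in_qpoly_eq0 (h P : {poly int}) : (1 < size h)%N -> h \is monic ->
  in_qpoly h P = 0 <-> exists Q, P = Q * h.
Proof.
move=> h_gt1 mon_h; have Dh : mk_monic h = h by rewrite /mk_monic h_gt1 mon_h.
split=> [/(congr1 val) /= | [Q ->]].
  rewrite Dh => P0; exists (Pdiv.Ring.rdivp P h).
  by rewrite {1}(Pdiv.RingMonic.rdivp_eq mon_h P) P0 addr0.
by apply: val_inj; rewrite /= Dh Pdiv.RingMonic.rmodp_mull.
Qed.

(** [qtrinom_second_order] in the ring Z[X] / (Phi_n^2). *)
Lemma qtrinom_poly_mod A n : (0 < n)%N ->
  exists Q, qtrinom_poly A n =
    (2 * 'C(A.+2, 2))%:R * (1 + lucas_sum 'X n)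
    - (3 * n * 'C(A.+3, 3))%:R * (1 - 'X^n)
    + (A.+2%:R - 'C(A.+2, 2)%:R) + Q * 'Phi_n ^+ 2.
Proof.
move=> n_gt0; have [z prim_z] := C_prim_root_exists n_gt0.
pose h := 'Phi_n ^+ 2.
have mon_h : h \is monic by rewrite monic_exp ?Cyclotomic_monic.
have h_gt1 : (1 < size h)%N.
  rewrite /h expr2 size_monicM ?monic_neq0 ?Cyclotomic_monic //.
  by rewrite size_Cyclotomic addnS /= addSn ltnS addn_gt0 totient_gt0 n_gt0.
pose f : {rmorphism {poly int} -> {poly %/ h}} := in_qpoly h.
have f0 := in_qpoly_eq0 _ h_gt1 mon_h.
suff /f0[Q DQ] : f (qtrinom_poly A n
    - ((2 * 'C(A.+2, 2))%:R * (1 + lucas_sum 'X n)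
       - (3 * n * 'C(A.+3, 3))%:R * (1 - 'X^n)
       + (A.+2%:R - 'C(A.+2, 2)%:R))) = 0.
  by exists Q; rewrite -DQ addrC subrK.
have f_exp i : f (1 - 'X^i) = 1 - f 'X ^+ i by rewrite rmorphB rmorph1 rmorphXn.
have y_sqr0 : (1 - f 'X ^+ n) * (1 - f 'X ^+ n) = 0.
  rewrite -f_exp -rmorphM; apply/f0.
  have [S DS] : exists S, 1 - 'X^n = S * 'Phi_n.
    apply: (Cyclotomic_dvd_root prim_z); rewrite rmorphB rmorph1 /= map_polyXn.
    by rewrite /root !hornerE (prim_expr_order prim_z) subrr.
  by exists (S * S); rewrite DS mulrACA.
have reg_t i : ~~ (n %| i)%N -> GRing.lreg (1 - f 'X ^+ i).
  move=> ndvd_i; rewrite -f_exp; apply: mulrI0_lreg => u.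
  have -> : u = f (val u).
    by apply: val_inj; rewrite [RHS]in_qpoly_small ?size_mk_monic.
  rewrite -rmorphM => /f0 DPQ; apply/f0.
  apply: (Cyclotomic_pow_cancel prim_z _ DPQ).
  rewrite rmorphB rmorph1 /= map_polyXn /root !hornerE subr_eq0 eq_sym.
  by rewrite -(prim_order_dvd prim_z).
have E := qtrinom_second_order n_gt0 y_sqr0 reg_t A.
rewrite rmorphB; apply/eqP; rewrite subr_eq0; apply/eqP.
have f_gauss N k : f (gauss 'X N k) = gauss (f 'X) N k by rewrite rmorph_gauss.
have f_lucas : f (lucas_sum 'X n) = lucas_sum (f 'X) n.
  rewrite rmorph_sum; apply: eq_bigr => k _.
  by rewrite !rmorphM rmorph_sign rmorphXn rmorphD rmorphM rmorphXn !f_gauss.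
transitivity (\sum_(0 <= k < n.+1) f 'X ^+ (k * (k + A * n))
    * gauss (f 'X) (A.+2 * n) k * gauss (f 'X) (A.+2 * n - k) (k + A * n)).
  rewrite rmorph_sum; apply: eq_bigr => k _.
  by rewrite !rmorphM rmorphXn !f_gauss.
rewrite E; move: (2 * 'C(A.+2, 2))%N 'C(A.+2, 2) (3 * n * 'C(A.+3, 3))%N A.+2.
move=> c1 c2 c3 c4; rewrite (rmorphD f) (rmorphB f) !(rmorphM f) (rmorphD f 1).
by rewrite (rmorph1 f) f_lucas f_exp (rmorphB f) !(rmorph_nat f).
Qed.

Lemma ratfun_nat_neq0 k : k.+1%:R != 0 :> ratfun.
Proof.
rewrite -(rmorph_nat (@tofrac {poly int})) tofrac_eq0 -polyC_natr polyC_eq0.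
by rewrite Num.Theory.pnatr_eq0.
Qed.

(** The three cases of the theorem differ only in the value of the q-Lucas
    sum. *)
Lemma qtrinom_mod A n L : (0 < n)%N -> 1 + lucas_sum q n = L ->
  laurent_eqmod (qtrinom (A.+2 * n) ((A.+2 * n)%:Z - (2 * n)%:Z))
    (2 * 'C(A.+2, 2)%:R * L - 3 * n%:R * (1 - q ^+ n) * 'C(A.+3, 3)%:R
     + (3 * A.+2%:R - A.+2%:R ^+ 2) / 2)
    (of_poly 'Phi_n ^+ 2).
Proof.
move=> n_gt0 <-; have [Q DQ] := qtrinom_poly_mod A n_gt0.
exists (of_poly Q); first by exists Q, 0; rewrite expr0 divr1.
rewrite qtrinom_polyE DQ.
have D2 : (3 * A.+2%:R - A.+2%:R ^+ 2) / 2 = A.+2%:R - 'C(A.+2, 2)%:R :> ratfun.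
  have := mul_bin_diag A.+2 1; rewrite bin1 /=.
  move=> /(congr1 (fun k => k%:R : ratfun)).
  rewrite !natrM => E; apply: (mulIf (ratfun_nat_neq0 1)).
  rewrite mulfVK ?(ratfun_nat_neq0 1) //.
  transitivity (2 * A.+2%:R - 2 * 'C(A.+2, 2)%:R : ratfun); last by ring.
  by rewrite -E -(addn1 A.+1) natrD; ring.
have f_lucas : of_poly (lucas_sum 'X n) = lucas_sum q n.
  rewrite /of_poly rmorph_sum; apply: eq_bigr => k _.
  rewrite !rmorphM rmorph_sign rmorphXn rmorphD rmorphM rmorphXn.
  by rewrite !rmorph_gauss.
have morph (f : {rmorphism {poly int} -> ratfun}) c2 c3 a S P :
    f ((2 * c2)%:R * (1 + S) - (3 * n * c3)%:R * (1 - 'X^n) + (a%:R - c2%:R)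
       + Q * P ^+ 2) =
    2 * c2%:R * (1 + f S) - 3 * n%:R * c3%:R * (1 - f 'X ^+ n)
    + (a%:R - c2%:R) + f Q * f P ^+ 2.
  rewrite !natrM !(rmorphD f, rmorphN f, rmorphM f, rmorphXn f, rmorph1 f).
  by rewrite !(rmorph_nat f); ring.
rewrite [of_poly _]morph -[_ (lucas_sum _ _)]/(of_poly _) -[_ Q]/(of_poly _).
by rewrite f_lucas D2; ring.
Qed.

Theorem theorem1p3 (a n : nat) (m : int) (ha : (2 <= a)%N) (hn : (0 < n)%N) :
  [/\ n%:Z = 3 * m ->
      laurent_eqmod (qtrinom (a * n)%N ((a * n)%:Z - (2 * n)%:Z))
        ((-1) ^ m * 2 * 'C(a, 2)%:R * (1 + q ^ m)
             * q ^ (m * (3 * m - 1) %/ 2)%Z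
         - 9 * m%:~R * (1 - q ^ (3 * m)) * 'C(a.+1, 3)%:R
         + (3 * a%:R - a%:R ^+ 2) / 2)
        (of_poly 'Phi_n ^+ 2),
      n%:Z = 3 * m + 1 ->
      laurent_eqmod (qtrinom (a * n)%N ((a * n)%:Z - (2 * n)%:Z))
        ((-1) ^ m * 2 * 'C(a, 2)%:R * q ^ (m * (3 * m + 1) %/ 2)%Z
         - 3 * (3 * m + 1)%:~R * (1 - q ^ (3 * m + 1)) * 'C(a.+1, 3)%:R
         + (3 * a%:R - a%:R ^+ 2) / 2)
        (of_poly 'Phi_n ^+ 2)
    & n%:Z = 3 * m - 1 ->
      laurent_eqmod (qtrinom (a * n)%N ((a * n)%:Z - (2 * n)%:Z))
        ((-1) ^ m * 2 * 'C(a, 2)%:R * q ^ (m * (3 * m - 1) %/ 2)%Z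
         - 3 * (3 * m - 1)%:~R * (1 - q ^ (3 * m - 1)) * 'C(a.+1, 3)%:R
         + (3 * a%:R - a%:R ^+ 2) / 2)
        (of_poly 'Phi_n ^+ 2)].
Proof.
case: a ha => [|[|A]] // _.
have bin2_half k : (2 * 'C(k, 2) + k = k * k)%N.
  by have := mul_bin_diag k 1; rewrite bin1; case: k => //=; nia.
split=> Dn.
- case: m Dn => [[|m]|m] Dn; try by exfalso; lia.
  have {}Dn : n = (3 * m.+1)%N by lia.
  have expE : ((m.+1%:Z * (3 * m.+1%:Z - 1)) %/ 2)%Z
      = (m.+1 + 3 * 'C(m.+1, 2))%:Z.
    by have := bin2_half m.+1; move: 'C(_, 2) => c; nia.
  have DL := lucas_sum_mod0 q m; rewrite -Dn in DL.
  have nE : 9 * m.+1%:~R = 3 * n%:R :> ratfun.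
    by rewrite Dn natrM mulrA -natrM.
  rewrite expE; have -> : 3 * m.+1%:Z = n%:Z by lia.
  congr (laurent_eqmod _ _ _): (qtrinom_mod A hn DL).
  by rewrite nE -!exprnP; ring.
- case: m Dn => [m|m] Dn; last by exfalso; lia.
  have {}Dn : n = (3 * m).+1 by lia.
  have expE : ((m%:Z * (3 * m%:Z + 1)) %/ 2)%Z = (2 * m + 3 * 'C(m, 2))%:Z.
    by have := bin2_half m; move: 'C(_, 2) => c; nia.
  have DL := lucas_sum_mod1 q m; rewrite -Dn in DL.
  rewrite expE; have -> : 3 * m%:Z + 1 = n%:Z by lia.
  congr (laurent_eqmod _ _ _): (qtrinom_mod A hn DL).
  by rewrite -!exprnP -pmulrn; ring.
case: m Dn => [[|m]|m] Dn; try by exfalso; lia.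
have {}Dn : n = (3 * m).+2 by lia.
have expE : ((m.+1%:Z * (3 * m.+1%:Z - 1)) %/ 2)%Z
      = (m.+1 + 3 * 'C(m.+1, 2))%:Z.
  by have := bin2_half m.+1; move: 'C(_, 2) => c; nia.
have DL := lucas_sum_mod2 q m; rewrite -Dn in DL.
rewrite expE; have -> : 3 * m.+1%:Z - 1 = n%:Z by lia.
congr (laurent_eqmod _ _ _): (qtrinom_mod A hn DL).
by rewrite -!exprnP -pmulrn; ring.
Qed.
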